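(* Let $L_\psi>0$ and let $\phi:\mathbb{R}^N\to\mathbb{R}\cup\{+\infty\}$ be a proper, lower semicontinuous, $\rho$-weakly convex function with $\rho=1-\frac1{L_\psi}$ and with prox-bound $\lambda_\phi>1$. Let $\epsilon>0$ and let $g_a:\mathbb{R}^N\to\mathbb{R}^N$ be an $\epsilon$-type (a) approximation of $\mathrm{prox}_\phi$. Then $$\forall x,y\in\mathbb{R}^N,\quad \|g_a(x)-g_a(y)\|\le L_\psi\|x-y\|+2\epsilon .$$
   Context: $\phi$ is $\rho$-weakly convex if $\phi+\frac{\rho}{2}\|\cdot\|^2$ is convex. The prox-bound $\lambda_\phi$ is the supremum of all $\lambda>0$ such that $\inf_{x}\{\phi(x)+\frac1{2\lambda}\|x-y\|^2\}>-\infty$ for some $y\in\mathbb{R}^N$. The proximal operator is $\mathrm{prox}_\phi(y)=\operatorname{argmin}_{x\in\mathbb{R}^N}\{\phi(x)+\frac12\|x-y\|^2\}$. $g_a$ is an $\epsilon$-type (a) approximation of $\mathrm{prox}_\phi$ if for all $y\in\mathbb{R}^N$ there exists $e(y)\in\mathbb{R}^N$ with $\|e(y)\|\le\epsilon$ and $g_a(y)=\mathrm{prox}_\phi(y)+e(y)$. *)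

(* Defs.v *)
From HB Require Import structures.
From mathcomp Require Import all_boot all_order all_algebra.
From mathcomp Require Import all_classical all_reals all_analysis.

Set Implicit Arguments.
Unset Strict Implicit.
Unset Printing Implicit Defensive.

Import Order.TTheory GRing.Theory Num.Theory.
Import numFieldNormedType.Exports.

Local Open Scope classical_set_scope.
Local Open Scope ring_scope.
Local Open Scope ereal_scope.

(* Functions R^N -> R U {+oo} are encoded as phi : 'rV[R]_N -> \bar R; the value
   -oo is excluded by [proper_efun]. *)

(* The canonical norm on 'rV[R]_N is the sup norm, hence a separate Euclidean
   norm; both induce the topology used by [lower_semicontinuous]. *)
Definition enorm (R : realType) (N : nat) (x : 'rV[R]_N) : R :=
  Num.sqrt (\sum_(i < N) x ord0 i ^+ 2)%R.

Definition proper_efun (R : realType) (N : nat) (f : 'rV[R]_N -> \bar R) : Prop :=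
  (forall x, -oo < f x) /\ (exists x, f x < +oo).

(* With the convention 0 * +oo = 0 of \bar R, the cases t = 0 and t = 1 are
   harmless. *)
Definition convex_efun (R : realType) (N : nat) (f : 'rV[R]_N -> \bar R) : Prop :=
  forall (x y : 'rV[R]_N) (t : R), (0 <= t <= 1)%R ->
    f (t *: x + (1 - t) *: y)%R <= t%:E * f x + (1 - t)%:E * f y.

Definition weakly_convex (R : realType) (N : nat) (rho : R)
    (phi : 'rV[R]_N -> \bar R) : Prop :=
  convex_efun (fun x => phi x + (rho / 2 * enorm x ^+ 2)%:E).

Definition prox_bound (R : realType) (N : nat) (phi : 'rV[R]_N -> \bar R) :
    \bar R :=
  ereal_sup [set lambda%:E | lambda in
    [set lambda : R | (0 < lambda)%R /\
      exists y : 'rV[R]_N,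
        -oo < ereal_inf (range (fun x : 'rV[R]_N =>
                phi x + (1 / (2 * lambda) * enorm (x - y) ^+ 2)%:E))]].

Definition argmin (R : realType) (N : nat) (f : 'rV[R]_N -> \bar R) :
    set 'rV[R]_N :=
  [set x | forall z, f x <= f z].

(* [prox] as a single-valued map: a point of the argmin. The value 0 is a
   default for an empty argmin; that the argmin is a singleton is a consequence
   of the assumptions made on phi where [prox] is used, not an extra
   assumption. *)
Definition prox (R : realType) (N : nat) (phi : 'rV[R]_N -> \bar R)
    (y : 'rV[R]_N) : 'rV[R]_N :=
  xget 0%R (argmin (fun x => phi x + (1 / 2 * enorm (x - y) ^+ 2)%:E)).

Definition type_a_approx (R : realType) (N : nat) (eps : R)
    (phi : 'rV[R]_N -> \bar R) (g : 'rV[R]_N -> 'rV[R]_N) : Prop :=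
  forall y : 'rV[R]_N, exists e : 'rV[R]_N,
    (enorm e <= eps)%R /\ g y = (prox phi y + e)%R.

(* Main.v *)
Require Import Defs.
From mathcomp Require Import all_boot all_order all_algebra.
From mathcomp Require Import all_classical all_reals all_analysis.
From mathcomp Require Import ring lra.
Import Order.TTheory GRing.Theory Num.Theory.
Import numFieldNormedType.Exports.
Local Open Scope ring_scope.

(** Everything reduces to the exact proximal map being Lipschitz with constant
    [Lpsi]: the two error terms cost at most [eps] each by the triangle
    inequality.

    Existence. [prox] is an arbitrary point of the argmin, so the argmin has to
    be nonempty. A prox-bound above 1 gives some [l > 1] and [y0] for which
    [phi + |. - y0|^2 / (2 l)] is bounded below. As [1 / 2 > 1 / (2 l)], the
    objective [phi + |. - y|^2 / 2] then grows quadratically at infinity, so its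
    sublevel sets lie in a compact box, on which the lower semicontinuous
    objective attains its minimum ([argmin_prox_obj_nonempty]).

    Lipschitz estimate. Let [p] and [q] be minimizers for the centers [x] and
    [y]. Comparing [p] with the points of the segment towards [q] and letting
    these tend to [p] gives the first-order inequality
      [phi p - phi q <= <q - p, p - x> + rho / 2 * |q - p|^2]
    ([argmin_variational]); this is the inequality saying that [x - p] is a
    [rho]-weak subgradient of [phi] at [p], obtained without differentiating
    [phi]. Adding the same inequality with the roles of [p] and [q] exchanged
    eliminates [phi] and leaves [(1 - rho) |p - q|^2 <= <p - q, x - y>]. Since
    [1 - rho = 1 / Lpsi], Cauchy-Schwarz concludes ([argmin_lipschitz]). *)

(** * Euclidean inner product and norm *)

Section Euclidean.
Context {R : realType} {N : nat}.
Implicit Types (x y z : 'rV[R]_N) (t : R).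

Definition dot x y : R := \sum_(i < N) x ord0 i * y ord0 i.

Lemma dotC x y : dot x y = dot y x.
Proof. by apply: eq_bigr => i _; rewrite mulrC. Qed.

Lemma dotDl x y z : dot (x + y) z = dot x z + dot y z.
Proof. by rewrite -big_split; apply: eq_bigr => i _; rewrite mxE mulrDl. Qed.

Lemma dotZl t x z : dot (t *: x) z = t * dot x z.
Proof. by rewrite /dot mulr_sumr; apply: eq_bigr => i _; rewrite mxE mulrA. Qed.

Lemma dotNl x z : dot (- x) z = - dot x z.
Proof. by rewrite -scaleN1r dotZl mulN1r. Qed.

Lemma dotDr x y z : dot z (x + y) = dot z x + dot z y.
Proof. by rewrite dotC dotDl !(dotC z). Qed.

Lemma dotZr t x z : dot z (t *: x) = t * dot z x.
Proof. by rewrite dotC dotZl (dotC z). Qed.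

Lemma dotNr x z : dot z (- x) = - dot z x.
Proof. by rewrite dotC dotNl (dotC z). Qed.

Definition dotE := (dotDl, dotDr, dotNl, dotNr, dotZl, dotZr).

Lemma dot_ge0 x : 0 <= dot x x.
Proof. by apply: sumr_ge0 => i _; rewrite -expr2 sqr_ge0. Qed.

Lemma enorm_ge0 x : 0 <= enorm x.
Proof. exact: sqrtr_ge0. Qed.

Lemma sqr_enorm x : enorm x ^+ 2 = dot x x.
Proof.
rewrite sqr_sqrtr; last by apply: sumr_ge0 => i _; rewrite sqr_ge0.
by apply: eq_bigr => i _; rewrite expr2.
Qed.

Lemma enormN x : enorm (- x) = enorm x.
Proof. by congr Num.sqrt; apply: eq_bigr => i _; rewrite mxE sqrrN. Qed.

Lemma sqr_coord_le_dot x i : x ord0 i ^+ 2 <= dot x x.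
Proof.
rewrite /dot (bigD1 i)//= -expr2 lerDl.
by apply: sumr_ge0 => j _; rewrite -expr2 sqr_ge0.
Qed.

Lemma enorm_eq0 x : enorm x = 0 -> x = 0.
Proof.
move=> x0; apply/rowP => i; rewrite mxE; apply/eqP; rewrite -sqrf_eq0 eq_le.
by rewrite sqr_ge0 andbT (le_trans (sqr_coord_le_dot x i))// -sqr_enorm x0 expr0n.
Qed.

(** Cauchy-Schwarz, by expanding [0 <= | |y| x - |x| y |^2], which is
    [2 |x| |y| (|x| |y| - <x, y>)]; hence the separate case of a null norm. *)
Lemma dot_le_enormM x y : dot x y <= enorm x * enorm y.
Proof.
have [x0|x_neq0] := eqVneq (enorm x) 0.
  by rewrite x0 mul0r (enorm_eq0 _ x0) -(scale0r 0) dotZl mul0r.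
have [y0|y_neq0] := eqVneq (enorm y) 0.
  by rewrite y0 mulr0 (enorm_eq0 _ y0) -(scale0r 0) dotZr mul0r.
have xy_gt0 : 0 < enorm x * enorm y.
  by rewrite mulr_gt0// lt0r ?x_neq0 ?y_neq0 enorm_ge0.
have := dot_ge0 (enorm y *: x - enorm x *: y).
rewrite !dotE -!sqr_enorm (dotC y x) => h.
by rewrite -(ler_pM2l xy_gt0); lra.
Qed.

Lemma ler_enormD x y : enorm (x + y) <= enorm x + enorm y.
Proof.
rewrite -(@ler_pXn2r _ 2)// ?nnegrE ?addr_ge0 ?enorm_ge0//.
rewrite sqr_enorm !dotE -!sqr_enorm (dotC y x).
by have := dot_le_enormM x y; lra.
Qed.

Lemma continuous_sqr_enormB y :
  continuous (fun z => enorm (z - y) ^+ 2 : R).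
Proof.
under eq_fun do rewrite sqr_enorm.
rewrite /dot; apply: continuous_big => [|i _ z]; first exact: add_continuous.
have zi : continuous (fun z : 'rV[R]_N => (z - y) ord0 i).
  rewrite (_ : (fun z => _) = fun z : 'rV[R]_N => z ord0 i - y ord0 i); last first.
    by apply/funext => x; rewrite !mxE.
  move=> x; exact: (@cvgB R R^o _ (nbhs x) _ _ _ _ _
    (@coord_continuous R 1 N ord0 i x) (cvg_cst (y ord0 i))).
exact: (@cvgM R _ (nbhs z) _ _ _ _ _ (zi z) (zi z)).
Qed.

End Euclidean.

(** * Minimization of lower semicontinuous functions *)

Section LowerSemicontinuous.
Context {R : realType}.
Local Open Scope classical_set_scope.
Local Open Scope ereal_scope.

Lemma lower_semicontinuousD_continuous {T : topologicalType} (f : T -> \bar R)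
    (h : T -> R) :
  lower_semicontinuous f -> continuous h ->
  lower_semicontinuous (fun x => f x + (h x)%:E).
Proof.
move=> lscf conth x a; rewrite -lteBlDr// -EFinB => afx.
(* A real b strictly between a - h x and f x splits the margin between f and
   h; when f x = +oo any b above a - h x will do. *)
have [b ab bfx] : exists2 b : R, (a - h x < b)%R & b%:E < f x.
  case: (f x) afx => [r|_|//].
    by rewrite lte_fin => ar; exists ((a - h x + r) / 2)%R; rewrite ?lte_fin; lra.
  by exists (a - h x + 1)%R; [lra|rewrite ltry].
have [V xV Vb] := lscf _ _ bfx.
have hab : \forall y \near x, (a - b < h y)%R.
  by apply: (cvgr_gt (h x)); [exact: conth|lra].
exists (V `&` [set y | (a - b < h y)%R]); first exact: filterI.
move=> y [/Vb bfy /= aby]; rewrite -lteBlDr// -EFinB.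
by apply: le_lt_trans bfy; rewrite lee_fin; lra.
Qed.

(** The sublevel sets [B z] of [f] through the points of [K] are totally ordered
    by inclusion, so they generate a proper filter on [K]. A cluster point [p] of
    it is a minimizer: if [f z < f p], lower semicontinuity would keep [f] above
    [f z] on a whole neighborhood of [p], which must meet [B z]. *)
Lemma compact_lsc_min {T : topologicalType} (f : T -> \bar R) (K : set T) :
  lower_semicontinuous f -> compact K -> K !=set0 ->
  exists2 p, K p & forall z, K z -> f p <= f z.
Proof.
move=> lscf cptK [z0 Kz0].
pose B z := [set x | K x /\ f x <= f z].
pose F := filter_from K B.
have FF : ProperFilter F.
  apply: filter_from_proper => [|z Kz]; last by exists z.
  apply: filter_from_filter => [|z w Kz Kw]; first by exists z0.
  have [zw|/ltW wz] := leP (f z) (f w).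
    by exists z => // x [Kx xz]; split; split => //; exact: le_trans zw.
  by exists w => // x [Kx xw]; split; split => //; exact: le_trans wz.
have FK : F K by exists z0 => // x [].
have [p [Kp clp]] := cptK F FF FK.
exists p => // z Kz; rewrite leNgt; apply/negP => zp.
have [a za ap] : exists2 a : R, f z <= a%:E & a%:E < f p.
  case: (f z) zp => [r rp||]; [by exists r|by rewrite ltNge leey|].
  case: (f p) => [s _|_|//]; last by exists 0%R; rewrite ?leNye ?ltry.
  by exists (s - 1)%R; rewrite ?leNye// lte_fin; lra.
have [V pV Va] := lscf _ _ ap.
have FBz : F (B z) by exists z.
have [x [[_ xz] Vx]] := clp _ _ FBz pV.
by have := lt_le_trans (Va _ Vx) (le_trans xz za); rewrite ltxx.
Qed.

End LowerSemicontinuous.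

(** * Existence of proximal points *)

Section Prox.
Context {R : realType} {N : nat}.
Implicit Types (phi : 'rV[R]_N -> \bar R) (x y p q : 'rV[R]_N).

Definition prox_obj phi y := (fun z => phi z + (1 / 2 * enorm (z - y) ^+ 2)%:E)%E.

Lemma compact_box x (r : R) :
  compact [set z : 'rV[R]_N | forall i, `|z ord0 i - x ord0 i| <= r]%classic.
Proof.
have := @rV_compact R N (fun i => `[x ord0 i - r, x ord0 i + r]%classic)
  (fun i => @segment_compact _ _ _).
congr compact; apply/seteqP; split => z /= zr i; have := zr i.
  by rewrite in_itv/= ler_distl.
by rewrite in_itv/= ler_distl.
Qed.

(** The growth estimate behind existence. With [d = (1 - 1/l) / 2 > 0],
    [u = z - y0] and [w = y - y0], the objective at [z] is at least
    [m + d |u|^2 - <u, w> + |w|^2 / 2], and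
    [<u, w> <= d / 2 * |u|^2 + |w|^2 / (2 d)] absorbs the cross term. *)
Lemma argmin_prox_obj_nonempty phi y :
  proper_efun phi -> lower_semicontinuous phi -> (1%:E < prox_bound phi)%E ->
  (argmin (prox_obj phi y) !=set0)%classic.
Proof.
move=> [phiNy [z0 phiz0]] lscphi /ereal_sup_gt[_ [l [l_gt0 [y0 infphi]] <-]].
rewrite lte_fin => l_gt1.
have [m phim] : exists m : R, forall z,
    (m%:E <= phi z + (1 / (2 * l) * enorm (z - y0) ^+ 2)%:E)%E.
  move: infphi; set I := ereal_inf _ => infphi.
  have Ile z : (I <= phi z + (1 / (2 * l) * enorm (z - y0) ^+ 2)%:E)%E.
    by apply: ereal_inf_lbound; exists z.
  case: I infphi Ile => [m _ Ile|_ Ile|//]; first by exists m.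
  (* An infinite infimum exceeds any real number, for instance 0. *)
  by exists 0 => z; apply: le_trans (Ile z); rewrite leey.
have [c phiz0E] : exists c : R, prox_obj phi y z0 = c%:E.
  rewrite /prox_obj; case: (phi z0) (phiNy z0) phiz0 => // s _ _.
  by eexists; rewrite -EFinD.
have [d dE] : exists d, d = (1 - l^-1) / 2 by exists ((1 - l^-1) / 2).
have d_gt0 : 0 < d by rewrite dE divr_gt0// subr_gt0 invf_lt1.
have [w wE] : exists w, w = y - y0 by exists (y - y0).
(* C bounds |z - y0|^2 on the sublevel set of the value c taken at z0. *)
pose C := (2 / d) * (c - m + dot w w / (2 * d)).
have subK z : (prox_obj phi y z <= c%:E)%E -> dot (z - y0) (z - y0) <= C.
  move=> zc; have := phim z; move: zc; rewrite /prox_obj.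
  case: (phi z) (phiNy z) => [s _|//|//].
  rewrite -!EFinD !lee_fin !sqr_enorm.
  have -> : z - y = (z - y0) - w by rewrite wE opprB addrA subrK.
  have -> : 1 / (2 * l) = 1 / 2 - d by rewrite dE; field; rewrite gt_eqF.
  move: (z - y0) => u; rewrite !dotE (dotC w u) => h1 h2.
  have h3 := dot_ge0 (d *: u - w); move: h3; rewrite !dotE (dotC w u) => h3.
  rewrite /C mulrC -ler_pdivrMr ?divr_gt0//.
  have -> : dot u u / (2 / d) = dot u u * d / 2 by field; rewrite gt_eqF.
  have : dot u w <= d / 2 * dot u u + dot w w / (2 * d).
    rewrite -(ler_pM2l d_gt0).
    have -> : d * (d / 2 * dot u u + dot w w / (2 * d)) =
      d ^+ 2 * dot u u / 2 + dot w w / 2 by field; rewrite gt_eqF.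
    by lra.
  have := dot_ge0 w.
  by lra.
have lsc_obj : lower_semicontinuous (prox_obj phi y).
  apply: lower_semicontinuousD_continuous; first exact: lscphi.
  move=> v.
  exact: (@cvgM R _ (nbhs v) _ _ _ _ _ (cvg_cst _) (continuous_sqr_enormB y v)).
pose K := [set z : 'rV[R]_N | forall i, `|z ord0 i - y0 ord0 i| <= Num.sqrt C]%classic.
have Kz z : (prox_obj phi y z <= c%:E)%E -> K z.
  move=> /subK zC i; rewrite -sqrtr_sqr ler_wsqrtr//.
  by apply: le_trans zC; have := sqr_coord_le_dot (z - y0) i; rewrite !mxE.
have Kz0 : K z0 by apply: Kz; rewrite phiz0E.
have [||p Kp pmin] := @compact_lsc_min _ _ (prox_obj phi y) K lsc_obj.
- exact: compact_box.
- by exists z0.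
exists p => z; have [/Kz|/ltW zc] := leP (prox_obj phi y z) c%:E; first exact: pmin.
by apply: le_trans zc; rewrite -phiz0E; exact: pmin.
Qed.

Lemma prox_argmin phi y :
  proper_efun phi -> lower_semicontinuous phi -> (1%:E < prox_bound phi)%E ->
  argmin (prox_obj phi y) (prox phi y).
Proof.
move=> phi_proper lscphi bphi; have [p pmin] : (argmin (prox_obj phi y) !=set0)%classic;
  [exact: argmin_prox_obj_nonempty|exact: (xgetI 0 pmin)].
Qed.

Lemma argmin_fin_num phi y p :
  proper_efun phi -> argmin (prox_obj phi y) p -> exists a, phi p = a%:E.
Proof.
move=> [phiNy [z0 phiz0]] /(_ z0); rewrite /prox_obj.
case: (phi p) (phiNy p) => [a _ _|_|//]; first by exists a.
by case: (phi z0) phiz0.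
Qed.

(** * Lipschitz continuity of proximal points *)

Lemma ler_limit0 (a b c : R) :
  (forall t, 0 < t -> t <= 1 -> a <= b + t * c) -> a <= b.
Proof.
move=> abc; rewrite leNgt; apply/negP => ba.
(* t = (a - b) / (a - b + |c|) lies in ]0, 1] and satisfies t * c < a - b. *)
have d_gt0 : 0 < a - b + `|c| by rewrite ltr_wpDr// subr_gt0.
have /abc : 0 < (a - b) / (a - b + `|c|) by rewrite divr_gt0// subr_gt0.
rewrite ler_pdivrMr// mul1r lerDl normr_ge0 => /(_ isT).
apply/negP; rewrite -ltNge -ltrBrDl mulrAC ltr_pdivrMr// ltr_pM2l ?subr_gt0//.
by have := ler_norm c; lra.
Qed.

(** The minimality of [p] against [t q + (1 - t) p], with weak convexity bounding
    [phi] there, gives the claim multiplied by [t], up to an error of order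
    [t^2]; divide by [t] and let [t] tend to 0. *)
Lemma argmin_variational rho phi x p q (a b : R) :
  weakly_convex rho phi -> argmin (prox_obj phi x) p ->
  phi p = a%:E -> phi q = b%:E ->
  a - b <= dot (q - p) (p - x) + rho / 2 * dot (q - p) (q - p).
Proof.
move=> wc pmin pa qb; apply: (@ler_limit0 _ _ ((1 - rho) / 2 * dot (q - p) (q - p))).
move=> t t_gt0 t_le1; rewrite -(ler_pM2l t_gt0).
have := wc q p t; rewrite ltW//= t_le1 => /(_ isT).
have := pmin (t *: q + (1 - t) *: p); rewrite /prox_obj pa qb.
case: (phi _) => [s|_|//]; rewrite -?EFinM -?EFinD ?lee_fin//.
rewrite !sqr_enorm !dotE (dotC q p) (dotC x p) (dotC x q).
by lra.
Qed.

(** The value [1 - 1 / L] of the weak convexity modulus leaves strong convexity of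
    modulus [1 / L] in the proximal objective, whence the constant [L]. *)
Lemma argmin_lipschitz L phi x y p q :
  0 < L -> proper_efun phi -> weakly_convex (1 - 1 / L) phi ->
  argmin (prox_obj phi x) p -> argmin (prox_obj phi y) q ->
  enorm (p - q) <= L * enorm (x - y).
Proof.
move=> L_gt0 pphi wc pmin qmin.
have [a pa] := argmin_fin_num _ _ _ pphi pmin.
have [b qb] := argmin_fin_num _ _ _ pphi qmin.
have pq := argmin_variational _ _ _ _ _ _ _ wc pmin pa qb.
have qp := argmin_variational _ _ _ _ _ _ _ wc qmin qb pa.
(* The sum of pq and qp: the values a and b of phi cancel. *)
have monotone : dot (p - q) (p - q) <= L * dot (p - q) (x - y).
  rewrite -ler_pdivrMl//; move: pq qp.
  rewrite !dotE (dotC q p); lra.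
have [->|pq_neq0] := eqVneq (enorm (p - q)) 0.
  by rewrite mulr_ge0 ?enorm_ge0// ltW.
have pq_gt0 : 0 < enorm (p - q) by rewrite lt0r pq_neq0 enorm_ge0.
rewrite -(ler_pM2l pq_gt0) -expr2 sqr_enorm (le_trans monotone)//.
by rewrite mulrCA ler_pM2l// dot_le_enormM.
Qed.

End Prox.

Theorem proposition3 (R : realType) (N : nat) (Lpsi : R)
    (phi : 'rV[R]_N -> \bar R) (rho eps : R) (ga : 'rV[R]_N -> 'rV[R]_N)
    (hL : 0 < Lpsi)
    (hproper : proper_efun phi)
    (hlsc : lower_semicontinuous phi)
    (hrho : rho = 1 - 1 / Lpsi)
    (hwc : weakly_convex rho phi)
    (hbound : (1%:E < prox_bound phi)%E)
    (heps : 0 < eps)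
    (hga : type_a_approx eps phi ga) :
  forall x y : 'rV[R]_N,
    enorm (ga x - ga y) <= Lpsi * enorm (x - y) + 2 * eps.
Proof.
move=> x y; have [ex [ex_le ->]] := hga x; have [ey [ey_le ->]] := hga y.
rewrite opprD addrACA (le_trans (ler_enormD _ _))// lerD//.
  rewrite hrho in hwc; apply: (argmin_lipschitz _ _ _ _ _ _ hL hproper hwc).
    exact: prox_argmin.
  exact: prox_argmin.
rewrite (le_trans (ler_enormD _ _))// enormN; lra.
Qed.
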